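(* Let $(W_n)_{n\ge0}$ be the nearest neighbor symmetric random walk on $\mathbb{Z}$ started at $0$ (increments $\pm1$ with probability $1/2$ each), and for $n\in\mathbb{N}$ let $\tau_n=\min\{k\ge0: W_k\ge n\}$. Then for any $a>1$ there exists $c>0$ such that $$\lim_{n\to\infty}\frac{\log P\big(\tau_n\in[\,an-c\sqrt{n\log n},\;an+c\sqrt{n\log n}\,]\big)}{n}=-\log\Big((a+1)^{(a+1)/2}(a-1)^{(a-1)/2}a^{-a}\Big).$$ *)

(* Defs.v *)
From HB Require Import structures.
From mathcomp Require Import all_boot all_order all_algebra.
From mathcomp Require Import all_classical all_reals all_analysis.
Set Implicit Arguments.
Unset Strict Implicit.
Unset Printing Implicit Defensive.
Import Order.TTheory GRing.Theory Num.Theory.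
Import numFieldNormedType.Exports.
Local Open Scope classical_set_scope.
Local Open Scope ring_scope.

HB.instance Definition _ := isPointed.Build int 0.

(* int carries the discrete sigma-algebra, as nat does in MathComp-Analysis. *)
HB.instance Definition _ := @isMeasurable.Build default_measure_display
  int discrete_measurable discrete_measurable0
  discrete_measurableC discrete_measurableU.

(* Mutual independence: the product rule over every finite subfamily, a finite
   set of indices being given as a duplicate-free sequence. *)
Definition independent_RVs (d d' : measure_display) (T : measurableType d)
    (T' : measurableType d') (R : realType) (P : probability T R)
    (I : choiceType) (X : I -> T -> T') : Prop :=
  forall (s : seq I) (B : I -> set T'), uniq s ->
    (forall i, measurable (B i)) ->
    P (\bigcap_(i in [set` s]) X i @^-1` B i) =
      (\prod_(i <- s) P (X i @^-1` B i))%E.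

Definition increment (T : Type) (W : nat -> T -> int) (k : nat) (w : T) : int :=
  W k.+1 w - W k w.

Definition symmetric_nn_walk (d : measure_display) (T : measurableType d)
    (R : realType) (P : probability T R) (W : nat -> {RV P >-> int}) : Prop :=
  [/\ P [set w | W 0%N w = 0] = 1%E,
      (forall k, P [set w | increment W k w = 1] = (2^-1)%:E),
      (forall k, P [set w | increment W k w = -1] = (2^-1)%:E)
    & independent_RVs P (increment W)].

(* min {k >= 0 : W_k >= n}, with value +oo on paths that never reach n. *)
Definition hitting_time (R : realType) (T : Type) (W : nat -> T -> int)
    (n : nat) (w : T) : \bar R :=
  if pselect (exists k, n%:Z <= W k w) is left h
  then (ex_minn h)%:R%:E else +oo%E.

(* Main.v *)
Require Import Defs.
From mathcomp Require Import all_boot all_order all_algebra.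
From mathcomp Require Import all_classical all_reals all_analysis.
From mathcomp Require Import zify ring lra.
Import Order.TTheory GRing.Theory Num.Theory.
Import numFieldNormedType.Exports.
Local Open Scope classical_set_scope.
Local Open Scope ring_scope.

(* Both bounds on the probability of the window are exponential with the same
   rate. For the upper bound, [q ^ (- W_k) / C ^ k] with [C = (q + 1 / q) / 2] is a
   martingale, so the probability to reach [n] within [K] steps is at most
   [q ^ n C ^ K]; the best choice is [q = sqrt ((a - 1) / (a + 1))], and the width
   [sqrt (n ln n)] of the window is negligible with respect to [n]. For the lower
   bound, the window contains the time [k = n + 2 dn] with
   [dn = floor (n (a - 1) / 2)], the ballot theorem gives
   [P (tau_n = k) = (n / k) 'C(k, dn) / 2 ^ k], and Stirling's estimate of the
   binomial coefficient yields the rate. *)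

(** * Path events and their probabilities *)

(* Number of paths with steps 1 and -1 that start at 0 and hit [n] for the first
   time at time [k], by recursion on the first step. *)
Fixpoint first_passage_count (n k : nat) : nat :=
  match n, k with
  | 0, 0 => 1
  | 0, _.+1 => 0
  | _.+1, 0 => 0
  | m.+1, j.+1 => first_passage_count m j + first_passage_count m.+2 j
  end.

Definition step (b : bool) : int := if b then 1 else -1.

Definition height (t : seq bool) : int := \sum_(b <- t) step b.

Lemma height_rcons (t : seq bool) (b : bool) :
  height (rcons t b) = height t + step b.
Proof. by rewrite /height big_rcons /= addrC. Qed.

Section Cylinders.
Context {d : measure_display} {T : measurableType d} {R : realType}.
Context {P : probability T R} {W : nat -> {RV P >-> int}}.
Context (HW : symmetric_nn_walk W).

Definition first_reaches (n k : nat) : set T :=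
  [set w | n%:Z <= W k w /\ forall j, (j < k)%N -> W j w < n%:Z].

(** Prescribing increments rather than positions makes independence directly applicable. The event
    [W 0 = 0] is included because the walk starts at 0 only almost surely. *)
Definition cylinder (t : seq bool) : set T :=
  [set w | W 0%N w = 0] `&`
  \bigcap_(i in [set` iota 0 (size t)])
    increment W i @^-1` [set step (nth false t i)].

Lemma prob_le (A B : set T) :
  measurable A -> measurable B -> A `<=` B -> (P A <= P B)%E.
Proof. by move=> mA mB; apply: le_measure; rewrite inE. Qed.

Lemma prob_le_addU (A B C : set T) :
  measurable A -> measurable B -> measurable C -> A `<=` B `|` C ->
  (P A <= P B + P C)%E.
Proof.
move=> mA mB mC /(prob_le _ _ mA (measurableU _ _ mB mC)) /le_trans; apply.
exact: measureU2.
Qed.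

Lemma measurable_walk (k : nat) (B : set int) : measurable (W k @^-1` B).
Proof. exact: measurable_funPTI. Qed.

(** Splitting over the countably many values [m] of [W k] leaves only preimages under [W k] and
    [W k.+1]. *)
Lemma measurable_increment (k : nat) (B : set int) :
  measurable (increment W k @^-1` B).
Proof.
have -> : increment W k @^-1` B = \bigcup_(m : int)
    (W k @^-1` [set m] `&` W k.+1 @^-1` [set x | B (x - m)]).
  apply/seteqP; split => w /=; rewrite /increment.
    by move=> Bw; exists (W k w).
  by case=> m _ [/= -> ].
apply: countable_bigcupT_measurable => [|m]; first exact: countableP.
by apply: measurableI; exact: measurable_walk.
Qed.

Lemma measurable_first_reaches (n k : nat) : measurable (first_reaches n k).
Proof.
have -> : first_reaches n k = W k @^-1` [set x | n%:Z <= x] `&`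
    \bigcap_(j in `I_k) (W j @^-1` [set x | x < n%:Z]).
  by apply/seteqP; split.
apply: measurableI; first exact: measurable_walk.
apply: fin_bigcap_measurable => // j _.
exact: measurable_walk.
Qed.

Lemma measurable_cylinder (t : seq bool) : measurable (cylinder t).
Proof.
apply: measurableI; first exact: (measurable_walk 0 [set 0]).
apply: fin_bigcap_measurable => // j _.
exact: measurable_increment.
Qed.

Lemma prob_increment (k : nat) (b : bool) :
  P (increment W k @^-1` [set step b]) = (2^-1)%:E.
Proof. by case: HW => _ Hp Hm _; case: b; [exact: Hp|exact: Hm]. Qed.

(** Independence gives the product over the increments, and intersecting with the almost sure event
    [W 0 = 0] does not change it. *)
Lemma prob_cylinder (t : seq bool) : P (cylinder t) = (2^-1 ^+ size t)%:E.
Proof.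
have [H0 _ _ Hind] := HW.
set A := [set w | W 0%N w = 0].
have mA : measurable A by exact: (measurable_walk 0 [set 0]).
set B := \bigcap_(i in [set` iota 0 (size t)])
    increment W i @^-1` [set step (nth false t i)].
have mB : measurable B.
  apply: fin_bigcap_measurable => // j _.
  exact: measurable_increment.
have PB : P B = (2^-1 ^+ size t)%:E.
  rewrite /B Hind ?iota_uniq//.
  under eq_bigr do rewrite prob_increment.
  by rewrite prodEFin big_const_seq count_predT size_iota -Monoid.iteropE.
have nA : P (~` A) = 0 by rewrite probability_setC// H0 subee.
rewrite /cylinder -/A -/B -PB; apply/eqP; rewrite eq_le; apply/andP; split.
  by apply: prob_le => //; exact: measurableI.
have sub : B `<=` (A `&` B) `|` ~` A.
  by move=> w Bw; have [Aw|nAw] := pselect (A w); [left|right].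
have mAB : measurable (A `&` B) by exact: measurableI.
have mAC : measurable (~` A) by exact: measurableC.
by apply: le_trans (prob_le_addU _ _ _ mB mAB mAC sub) _; rewrite nA adde0.
Qed.

Lemma cylinder_walk (t : seq bool) (w : T) :
  cylinder t w -> W (size t) w = height t.
Proof.
elim/last_ind: t => [|t b IH] /=.
  by case=> /= -> _; rewrite /height big_nil.
case=> w0 winc; rewrite size_rcons height_rcons -IH; last first.
  split=> // i /=; rewrite mem_iota add0n => /andP[_ lit].
  have /= := winc i; rewrite size_rcons mem_iota add0n ltnS (ltnW lit).
  by move/(_ isT); rewrite nth_rcons lit.
have /= := winc (size t).
rewrite size_rcons mem_iota add0n ltnSn => /(_ isT).
rewrite nth_rcons ltnn eqxx /increment => <-.
by rewrite addrC subrK.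
Qed.

Lemma cylinder_rcons (t : seq bool) (b : bool) :
  cylinder (rcons t b) =
  cylinder t `&` increment W (size t) @^-1` [set step b].
Proof.
apply/seteqP; split => w.
  case=> w0 winc; split; last first.
    have /= := winc (size t).
    rewrite size_rcons mem_iota add0n ltnSn => /(_ isT).
    by rewrite nth_rcons ltnn eqxx.
  split=> // i /=; rewrite mem_iota add0n => /andP[_ lit].
  have /= := winc i; rewrite size_rcons mem_iota add0n ltnS (ltnW lit).
  by move/(_ isT); rewrite nth_rcons lit.
case=> -[w0 winc] /= wb; split=> // i /=.
rewrite size_rcons mem_iota add0n ltnS => /andP[_].
rewrite leq_eqVlt => /orP[/eqP->|lit].
  by rewrite nth_rcons ltnn eqxx.
by rewrite nth_rcons lit; apply: winc; rewrite /= mem_iota.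
Qed.

Lemma cylinder_rcons_disjoint (t : seq bool) :
  cylinder (rcons t true) `&` cylinder (rcons t false) = set0.
Proof.
rewrite !cylinder_rcons; apply/seteqP; split => w //=.
by case=> -[_ ->] [_].
Qed.

(** The values 1 and -1 already carry total mass 1; other values may occur, but only on a null
    set. *)
Lemma negligible_increment (k : nat) :
  P (~` (increment W k @^-1` [set step true] `|`
         increment W k @^-1` [set step false])) = 0.
Proof.
rewrite probability_setC; last by apply: measurableU;
  exact: measurable_increment.
have -> : P (increment W k @^-1` [set step true] `|`
             increment W k @^-1` [set step false]) = 1%E.
  have dis : increment W k @^-1` [set step true] `&`
             increment W k @^-1` [set step false] = set0.
    by apply/seteqP; split=> w //= [->].
  rewrite (measureU P _ _ dis); [|exact: measurable_increment..].
  transitivity ((2^-1)%:E + (2^-1)%:E : \bar R)%E.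
    by congr (_ + _)%E; exact: prob_increment.
  by rewrite -EFinD; congr _%:E; field.
by rewrite subee.
Qed.

(** * Upper bound: the exponential martingale *)

Definition reaches_by (t : seq bool) (n K : nat) : set T :=
  cylinder t `&`
  \bigcup_(j in `I_K.+1)
    (W (size t + j)%N @^-1` [set x | height t + n%:Z <= x]).

Lemma measurable_reaches_by (t : seq bool) (n K : nat) :
  measurable (reaches_by t n K).
Proof.
apply: measurableI; first exact: measurable_cylinder.
apply: fin_bigcup_measurable => [|j _]; first exact: finite_II.
exact: measurable_walk.
Qed.

(** First-step decomposition. Lengthening the prefix [t] plays the role of the Markov property:
    after an up step [n] levels remain, after a down step [n.+2], and other increments go to the
    null event. *)
Lemma reaches_byS (t : seq bool) (n K : nat) :
  reaches_by t n.+1 K.+1 `<=`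
  reaches_by (rcons t true) n K `|` reaches_by (rcons t false) n.+2 K `|`
  ~` (increment W (size t) @^-1` [set step true] `|`
      increment W (size t) @^-1` [set step false]).
Proof.
move=> w [ct [[|j] /= jK hj]].
  by move: hj; rewrite addn0 (cylinder_walk _ _ ct); lia.
have [wp|np] := pselect (increment W (size t) w = step true).
  left; left; split; first by rewrite cylinder_rcons.
  exists j => //=; rewrite size_rcons height_rcons addSnnS; move: hj.
  by rewrite /step; lia.
have [wm|nm] := pselect (increment W (size t) w = step false).
  left; right; split; first by rewrite cylinder_rcons.
  exists j => //=; rewrite size_rcons height_rcons addSnnS; move: hj.
  by rewrite /step; lia.
by right; case.
Qed.

(* Optional stopping for the martingale [q ^ (- W_k) / C ^ k]. *)
Lemma prob_reaches_by_le (q C : R) (t : seq bool) (n K : nat) :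
  0 < q -> C = (q + q^-1) / 2 ->
  (P (reaches_by t n K) <= (2^-1 ^+ size t * (q ^+ n * C ^+ K))%:E)%E.
Proof.
move=> q0 CE.
(* The arithmetic-geometric mean inequality; it settles the case [n = 0], where the bound is
   [C ^+ K] times the mass of the cylinder. *)
have C1 : 1 <= C.
  have : 0 <= (q - 1) ^+ 2 / (2 * q) by rewrite divr_ge0 ?sqr_ge0// mulr_ge0// ltW.
  rewrite CE (_ : (q - 1) ^+ 2 / (2 * q) = (q + q^-1) / 2 - 1) ?subr_ge0//.
  by field; rewrite gt_eqF.
elim: K t n => [|K IH] t [|n].
- rewrite mulr1 expr0 mulr1 -prob_cylinder.
  apply: prob_le; [exact: measurable_reaches_by|exact: measurable_cylinder|].
  by move=> w [].
- rewrite (_ : reaches_by t n.+1 0 = set0) ?measure0 ?lee_fin.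
    by rewrite !mulr_ge0 ?exprn_ge0// ?invr_ge0// ltW//; lra.
  apply/seteqP; split=> w //= [ct [[|//] _ /=]].
  by rewrite addn0 (cylinder_walk _ _ ct); lia.
- apply: (@le_trans _ _ (P (cylinder t))).
    apply: prob_le; [exact: measurable_reaches_by|exact: measurable_cylinder|].
    by move=> w [].
  rewrite prob_cylinder lee_fin ler_peMr ?exprn_ge0 ?invr_ge0//.
  by rewrite expr0 mul1r exprn_ege1.
- have mI b : measurable (increment W (size t) @^-1` [set step b]).
    exact: measurable_increment.
  have mN := measurableC (measurableU _ _ (mI true) (mI false)).
  have mU := measurable_reaches_by.
  have mUU := measurableU _ _ (mU (rcons t true) n K) (mU (rcons t false) n.+2 K).
  apply: (le_trans (prob_le_addU _ _ _ (mU _ _ _) mUU mN (reaches_byS _ _ _))).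
  rewrite negligible_increment adde0.
  apply: (le_trans (prob_le_addU _ _ _ mUU (mU _ _ _) (mU _ _ _)
    (@subset_refl _ _))).
  apply: (le_trans (leeD (IH _ _) (IH _ _))).
  (* Martingale identity: the average of [q ^+ n] and [q ^+ n.+2] is [q ^+ n.+1 * C]. *)
  rewrite -EFinD lee_fin !size_rcons le_eqVlt; apply/orP; left; apply/eqP.
  rewrite !exprS CE; field; by rewrite gt_eqF.
Qed.

(** * Lower bound: counting first-passage paths *)

Definition first_reaches_at (t : seq bool) (n k : nat) : set T :=
  cylinder t `&`
  (W (size t + k)%N @^-1` [set x | height t + n%:Z <= x] `&`
   \bigcap_(j in `I_k)
     (W (size t + j)%N @^-1` [set x | x < height t + n%:Z])).

Lemma measurable_first_reaches_at (t : seq bool) (n k : nat) :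
  measurable (first_reaches_at t n k).
Proof.
apply: measurableI; first exact: measurable_cylinder.
apply: measurableI; first exact: measurable_walk.
apply: fin_bigcap_measurable => // j _.
exact: measurable_walk.
Qed.

(** First-step decomposition in the direction of a lower bound; the longer cylinders force a step 1
    or -1, so no null event enters. *)
Lemma first_reaches_atS (t : seq bool) (n k : nat) :
  first_reaches_at (rcons t true) n k `|` first_reaches_at (rcons t false) n.+2 k
  `<=` first_reaches_at t n.+1 k.+1.
Proof.
move=> w [] [] ; rewrite cylinder_rcons => -[ct _] [/= h1 h2];
  (split; first exact: ct; split => /=; [|case=> [|j] /= jk]).
- by move: h1; rewrite size_rcons height_rcons addSnnS /step; lia.
- by rewrite addn0 (cylinder_walk _ _ ct); lia.
- move: (h2 j jk) => /=.
  by rewrite size_rcons height_rcons addSnnS /step; lia.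
- by move: h1; rewrite size_rcons height_rcons addSnnS /step; lia.
- by rewrite addn0 (cylinder_walk _ _ ct); lia.
- move: (h2 j jk) => /=.
  by rewrite size_rcons height_rcons addSnnS /step; lia.
Qed.

(** The two cylinders that extend [t] are disjoint, so their probabilities add up along the
    recursion of [first_passage_count]. *)
Lemma prob_first_reaches_at_ge (t : seq bool) (n k : nat) :
  ((2^-1 ^+ (size t + k) * (first_passage_count n k)%:R)%:E <=
   P (first_reaches_at t n k))%E.
Proof.
elim: k t n => [|k IH] t [|n] /=; rewrite ?mulr0 ?measure_ge0//.
- rewrite addn0 mulr1 -prob_cylinder.
  apply: prob_le; [exact: measurable_cylinder|exact: measurable_first_reaches_at|].
  move=> w ct; split=> //; split=> //=.
  by rewrite addn0 (cylinder_walk _ _ ct); lia.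
- have mV := measurable_first_reaches_at.
  apply: (@le_trans _ _ (P (first_reaches_at (rcons t true) n k `|`
      first_reaches_at (rcons t false) n.+2 k))); last first.
    apply: prob_le; [exact: measurableU|exact: mV|].
    exact: first_reaches_atS.
  have dis : first_reaches_at (rcons t true) n k `&`
      first_reaches_at (rcons t false) n.+2 k = set0.
    apply/seteqP; split=> w //= [[c1 _] [c2 _]].
    suff : set0 w by [].
    by rewrite -(cylinder_rcons_disjoint t).
  rewrite (measureU P (mV _ _ _) (mV _ _ _) dis).
  apply: le_trans (leeD (IH _ _) (IH _ _)).
  by rewrite !size_rcons !addSnnS -EFinD -mulrDr -natrD.
Qed.

(** * Hitting times in a window *)

Definition hitting_window (n : nat) (lo hi : R) : set T :=
  [set w | (lo%:E <= hitting_time R W n w <= hi%:E)%E].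

(** The finite bound [hi] excludes the value [+oo], and a minimum equal to [k] is a first passage at
    [k]. *)
Lemma hitting_windowE (n : nat) (lo hi : R) :
  hitting_window n lo hi =
  \bigcup_(k in [set k : nat | lo <= k%:R <= hi]) first_reaches n k.
Proof.
rewrite /hitting_window /hitting_time; apply/seteqP; split => w /=.
  case: pselect => [h|_]; last by rewrite leye_eq andbF.
  case: ex_minnP => k nk kmin; rewrite !lee_fin => lohi.
  exists k => //; split=> // j jk; rewrite ltNge.
  by apply: contraL jk => /kmin; rewrite -leqNgt.
case=> k /= lohi [nk kmin]; case: pselect => [h|]; last by case; exists k.
case: ex_minnP => m nm mmin; suff -> : m = k by rewrite !lee_fin.
apply/eqP; rewrite eqn_leq mmin// leqNgt; apply/negP => /kmin.
by rewrite ltNge nm.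
Qed.

Lemma measurable_hitting_window (n : nat) (lo hi : R) :
  measurable (hitting_window n lo hi).
Proof.
rewrite hitting_windowE; apply: bigcup_measurable => k _.
exact: measurable_first_reaches.
Qed.

(** A passage in the window happens by time [Num.truncn hi]; the martingale bound applies with the
    empty prefix, off the null event [W 0 <> 0]. *)
Lemma prob_hitting_window_le (q C : R) (n : nat) (lo hi : R) :
  0 < q -> C = (q + q^-1) / 2 ->
  (P (hitting_window n lo hi) <= (q ^+ n * C ^+ Num.truncn hi)%:E)%E.
Proof.
move=> q0 CE.
have mC := measurable_cylinder [::].
have PC : P (~` cylinder [::]) = 0.
  by rewrite probability_setC// prob_cylinder subee.
have := prob_reaches_by_le q C [::] n (Num.truncn hi) q0 CE.
rewrite mul1r; apply: le_trans; rewrite -[leRHS]adde0 -PC.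
apply: prob_le_addU; [exact: measurable_hitting_window|
  exact: measurable_reaches_by|exact: measurableC|].
rewrite hitting_windowE => w [k /= /andP[_ khi] [nk _]].
have [cw|ncw] := pselect (cylinder [::] w); [left|by right].
split=> //; exists k; last by rewrite /= /height big_nil add0r add0n.
by rewrite /= ltnS truncn_ge_nat// (le_trans _ khi).
Qed.

Lemma prob_hitting_window_ge (n k : nat) (lo hi : R) :
  lo <= k%:R <= hi ->
  ((2^-1 ^+ k * (first_passage_count n k)%:R)%:E <=
   P (hitting_window n lo hi))%E.
Proof.
move=> lohi; have := prob_first_reaches_at_ge [::] n k.
rewrite add0n => /le_trans; apply; apply: prob_le.
- exact: measurable_first_reaches_at.
- exact: measurable_hitting_window.
rewrite hitting_windowE => w [_ []] /=.
rewrite /height big_nil add0r add0n => h1 h2.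
by exists k => //; split=> // j /h2; rewrite /= add0n add0r.
Qed.

End Cylinders.

(** * Counting first passages *)

Lemma first_passage_count_small (n k : nat) :
  (k < n)%N -> first_passage_count n k = 0.
Proof.
elim: k n => [|k IH] [|n] //= kn.
by rewrite !IH//; lia.
Qed.

(* The ballot theorem, cleared of the division by the length of the path. *)
Lemma first_passage_countE (n dn : nat) :
  ((n + dn.*2) * first_passage_count n (n + dn.*2) = n * 'C(n + dn.*2, dn))%N.
Proof.
have [k] := ubnP (n + dn.*2); elim: k n dn => // k IH [|n] dn.
  case: dn => [//|dn] _; by rewrite doubleS add0n /= muln0 mul0n.
case: dn => [|dn] ltk.
  (* Without down steps only the straight path counts. *)
  rewrite double0 addn0 bin0 muln1 /=.
  have := IH n 0%N; rewrite double0 addn0 bin0 muln1 => /(_ ltac:(lia)) IHn.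
  rewrite (@first_passage_count_small n.+2 n) ?addn0//.
  case: (n) IHn => [//|m] /eqP.
  by rewrite -[X in _ == X](muln1 m.+1) eqn_pmul2l// => /eqP ->; rewrite muln1.
have -> : (n.+1 + dn.+1.*2 = (n + dn.+1.*2).+1)%N by lia.
rewrite /=.
have := IH n dn.+1 ltac:(lia); have := IH n.+2 dn ltac:(lia).
have -> : (n.+2 + dn.*2 = n + dn.+1.*2)%N by lia.
set N := (n + dn.+1.*2)%N.
rewrite binS => h2 h1.
have h3 : (dn.+1 * 'C(N, dn.+1) = (N - dn) * 'C(N, dn))%N by rewrite mul_bin_left.
(* Both shorter paths have length [N], so multiplying by [N] makes both induction hypotheses usable;
   Pascal's rule and [h3] leave pure arithmetic. *)
apply/eqP; rewrite -(@eqn_pmul2l N); last by rewrite /N; lia.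
apply/eqP.
move: h1 h2 h3; set f1 := first_passage_count _ _; set f2 := first_passage_count _ _.
set b1 := 'C(_, _); set b2 := 'C(_, _).
have -> : (N - dn = n + dn + 2)%N by rewrite /N; lia.
have NE : N = (n + dn.*2 + 2)%N by rewrite /N; lia.
move=> h1 h2 h3.
have -> : (N * (N.+1 * (f1 + f2)) = N.+1 * (N * f1) + N.+1 * (N * f2))%N by ring.
rewrite h1 h2 NE.
clear -h3. nia.
Qed.

(** * Stirling bounds for factorials and binomial coefficients *)

Section Stirling.
Context {R : realType}.
Implicit Types n : nat.

Lemma ln_succ_sub_le n : (0 < n)%N -> ln n.+1%:R - ln n%:R <= n%:R^-1 :> R.
Proof.
move=> n0; have n0' : (0 : R) < n%:R by rewrite ltr0n.
rewrite -ln_div ?posrE ?ltr0n//.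
have -> : n.+1%:R / n%:R = 1 + n%:R^-1 :> R.
  by rewrite -natr1; field; rewrite gt_eqF.
by apply: le_ln1Dx; apply: (@lt_trans _ _ 0); rewrite ?invr_gt0//; lra.
Qed.

Lemma ln_succ_sub_ge n : (0 < n)%N -> n.+1%:R^-1 <= ln n.+1%:R - ln n%:R :> R.
Proof.
move=> n0; have n0' : (0 : R) < n%:R by rewrite ltr0n.
rewrite -lerN2 opprB -ln_div ?posrE ?ltr0n//.
have -> : n%:R / n.+1%:R = 1 + - n.+1%:R^-1 :> R.
  by rewrite -natr1; field; lra.
apply: le_ln1Dx.
by rewrite ltrN2 invf_lt1 ?ltr0n// ltr1n.
Qed.

(** From [n] to [n + 1] the left side grows by at most [ln (n + 1)], because
    [n * (ln (n + 1) - ln n) <= 1]. *)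
Lemma ln_fact_ge n : n%:R * ln n%:R - n%:R <= ln (n`!%:R) :> R.
Proof.
elim: n => [|[|n] IH]; first by rewrite !mul0r subr0 fact0 ln1.
  by rewrite (_ : 1`! = 1)%N// !ln1; lra.
rewrite factS natrM lnM ?posrE ?ltr0n ?fact_gt0//.
have := @ln_succ_sub_le n.+1 isT; rewrite -[X in _ <= X]mul1r ler_pdivlMr ?ltr0n//.
move: IH; rewrite -[n.+2%:R]natr1; lra.
Qed.

(** Here the right side grows by at least [ln (n + 1)], because
    [(n + 1) * (ln (n + 1) - ln n) >= 1]. The case [n = 0] uses the convention [ln 0 = 0]. *)
Lemma ln_fact_le n : ln (n`!%:R) <= n.+1%:R * ln n%:R - n%:R + 1 :> R.
Proof.
elim: n => [|[|n] IH]; first by rewrite fact0 ln1 ln0//; lra.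
  by rewrite !ln1; lra.
rewrite factS natrM lnM ?posrE ?ltr0n ?fact_gt0//.
have := @ln_succ_sub_ge n.+1 isT; rewrite -[X in X <= _]mul1r ler_pdivrMr ?ltr0n//.
move: IH; rewrite -[n.+3%:R]natr1 -[n.+2%:R]natr1; lra.
Qed.

(** The linear terms of the three factorial bounds cancel; only logarithms and constants are
    lost. *)
Lemma ln_bin_ge (u dn : nat) :
  (u + dn)%:R * ln (u + dn)%:R - u%:R * ln u%:R - dn%:R * ln dn%:R
    - ln u%:R - ln dn%:R - 2 <= ln ('C(u + dn, dn)%:R) :> R.
Proof.
have bE : ln ('C(u + dn, dn)%:R) = ln ((u + dn)`!%:R) - ln (u`!%:R) - ln (dn`!%:R) :> R.
  have := bin_fact (leq_addl u dn); rewrite addnK => /(congr1 (fun k => ln (k%:R : R))).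
  rewrite !natrM !lnM ?posrE ?mulr_gt0 ?ltr0n ?muln_gt0 ?fact_gt0 ?bin_gt0 ?leq_addl//.
  lra.
rewrite bE; have := ln_fact_ge (u + dn); have := ln_fact_le u; have := ln_fact_le dn.
by rewrite -!natr1 natrD; lra.
Qed.

End Stirling.

(** * Asymptotics *)

Section Limits.
Context {R : realType}.

Lemma cvg_invn : (n%:R^-1 : R) @[n --> \oo] --> 0.
Proof. by rewrite -cvg_shiftS; exact: cvg_harmonic. Qed.

Lemma cvg_sqrtr {I : Type} (F : set_system I) {FF : Filter F} (f : I -> R) :
  f @ F --> 0 -> Num.sqrt (f x) @[x --> F] --> 0.
Proof.
move=> f0; rewrite -[X in _ --> X](@sqrtr0 R).
by apply: (cvg_comp _ _ f0); exact: sqrt_continuous.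
Qed.

(** With [s] the square root of [n], [ln n = 2 * ln s <= 2 * s]. *)
Lemma cvg_lnn_div : (ln n%:R / n%:R : R) @[n --> \oo] --> 0.
Proof.
apply: (@squeeze_cvgr _ _ _ _ (cst 0) (fun n => 2 * Num.sqrt (n%:R^-1))).
- near=> n.
  have n1 : (1 <= n)%N by near: n; exists 1%N.
  have n0 : (0 : R) < n%:R by rewrite ltr0n.
  apply/andP; split; first by rewrite divr_ge0 ?ln_ge0 ?ler1n // ltW.
  set s := Num.sqrt (n%:R : R).
  have s0 : 0 < s by rewrite sqrtr_gt0.
  have sE : n%:R = s * s by rewrite -expr2 sqr_sqrtr// ltW.
  rewrite (sqrtrV (ltW n0)) -/s sE lnM ?posrE// ler_pdivrMr ?mulr_gt0//.
  have -> : 2 * s^-1 * (s * s) = 2 * s by field; rewrite gt_eqF.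
  by have := ln_sublinear s0; lra.
- exact: cvg_cst.
- rewrite -[X in _ --> X](mulr0 2); apply: cvgM; first exact: cvg_cst.
  exact: cvg_sqrtr cvg_invn.
Unshelve. all: by end_near. Qed.

Lemma cvg_sqrt_nlnn_div :
  (Num.sqrt (n%:R * ln n%:R) / n%:R : R) @[n --> \oo] --> 0.
Proof.
apply: cvg_trans (cvg_sqrtr _ _ cvg_lnn_div).
apply: near_eq_cvg; near=> n.
have n1 : (1 <= n)%N by near: n; exists 1%N.
have n0 : (0 : R) < n%:R by rewrite ltr0n.
have -> : n%:R * ln n%:R = n%:R ^+ 2 * (ln n%:R / n%:R) :> R.
  by field; rewrite gt_eqF.
have n2 := sqr_ge0 (n%:R : R).
rewrite (sqrtrM _ n2) sqrtr_sqr gtr0_norm//.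
by rewrite mulrAC divff ?mul1r ?gt_eqF.
Unshelve. all: by end_near. Qed.

Lemma cvg_truncn_div (b : R) : 0 < b ->
  ((Num.truncn (n%:R * b))%:R / n%:R : R) @[n --> \oo] --> b.
Proof.
move=> b0; apply: (@squeeze_cvgr _ _ _ _ (fun n => b - n%:R^-1) (cst b)).
- near=> n.
  have n1 : (1 <= n)%N by near: n; exists 1%N.
  have n0 : (0 : R) < n%:R by rewrite ltr0n.
  have /andP[h1 h2] := truncn_itv (ltW (mulr_gt0 n0 b0)).
  rewrite ler_pdivlMr// ler_pdivrMr// mulrBl mulVf ?gt_eqF//=.
  by move: h1 h2; rewrite -natr1; lra.
- rewrite -[X in _ --> X]subr0; apply: cvgB; [exact: cvg_cst|exact: cvg_invn].
- exact: cvg_cst.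
Unshelve. all: by end_near. Qed.

(** From [ln (1 / n) <= 1 / n - 1] one gets [n * ln n >= n - 1]. This makes the window wide enough
    to absorb rounding and parity. *)
Lemma sqrt_nlnn_ge1 (n : nat) : (2 <= n)%N -> 1 <= Num.sqrt (n%:R * ln n%:R) :> R.
Proof.
move=> n2; rewrite -[leLHS]sqrtr1 ler_wsqrtr//.
have n2' : 2 <= n%:R :> R by rewrite ler_nat.
have n0 : 0 < n%:R :> R by lra.
have : ln (n%:R^-1) <= n%:R^-1 - 1 :> R.
  rewrite [X in ln X](_ : _ = 1 + (n%:R^-1 - 1)); last by ring.
  by apply: le_ln1Dx; rewrite ltrBrDl subrr invr_gt0.
rewrite lnV ?posrE// => h.
have : n%:R * (1 - n%:R^-1) <= n%:R * ln n%:R :> R.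
  by rewrite ler_pM2l//; lra.
by rewrite mulrBr divff ?gt_eqF//; lra.
Qed.

(* Exponential rate of [2^-k 'C(k, dn)] for [k = n + 2 dn] and [z = dn / n]. *)
Definition path_rate (z : R) : R :=
  - ((1 + 2 * z) * ln 2) + (1 + 2 * z) * ln (1 + 2 * z)
  - (1 + z) * ln (1 + z) - z * ln z.

Definition hitting_rate (a : R) : R :=
  - ln ((a + 1) `^ ((a + 1) / 2) * (a - 1) `^ ((a - 1) / 2) * a `^ (- a)).

Lemma hitting_rateE (a : R) : 1 < a ->
  hitting_rate a = a * ln a - (a + 1) / 2 * ln (a + 1) - (a - 1) / 2 * ln (a - 1).
Proof.
move=> a1; rewrite /hitting_rate !lnM ?posrE ?mulr_gt0 ?powR_gt0//; try lra.
by rewrite !ln_powR; lra.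
Qed.

(** The [ln 2] terms cancel because [(a + 1) / 2 + (a - 1) / 2 = a]. *)
Lemma path_rateE (a : R) : 1 < a -> path_rate ((a - 1) / 2) = hitting_rate a.
Proof.
move=> a1; rewrite hitting_rateE// /path_rate.
have -> : 1 + 2 * ((a - 1) / 2) = a by field.
have -> : 1 + (a - 1) / 2 = (a + 1) / 2 by field.
by rewrite !ln_div ?posrE; lra.
Qed.

Lemma continuous_path_rate (z : R) : 0 < z -> {for z, continuous path_rate}.
Proof.
move=> z0.
have cid : x @[x --> z] --> z by exact: cvg_id.
have c2 : 1 + 2 * x @[x --> z] --> 1 + 2 * z.
  by apply: cvgD; [exact: cvg_cst|apply: cvgM => //; exact: cvg_cst].
have c1 : 1 + x @[x --> z] --> 1 + z by apply: cvgD => //; exact: cvg_cst.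
have cln (f : R -> R) : f x @[x --> z] --> f z -> 0 < f z ->
    f x * ln (f x) @[x --> z] --> f z * ln (f z).
  move=> cf f0; apply: cvgM => //.
  by apply: (cvg_comp _ _ cf); exact: continuous_ln.
rewrite /path_rate; apply: cvgB; last exact: (cln id).
apply: cvgB; last by apply: (cln (fun x => 1 + x)) => //; lra.
apply: cvgD; last by apply: (cln (fun x => 1 + 2 * x)) => //; lra.
by apply: cvgN; apply: cvgM => //; exact: cvg_cst.
Qed.

(** The ballot factor and the two Stirling corrections each cost at most [ln k <= ln a + ln n],
    whence the coefficients 3. *)
Lemma ln_first_passage_count_ge (a : R) (n dn : nat) : 1 < a ->
  (0 < n)%N -> (0 < dn)%N -> (n + dn.*2)%:R <= a * n%:R ->
  0 < 2^-1 ^+ (n + dn.*2) * (first_passage_count n (n + dn.*2))%:R :> R /\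
  n%:R * path_rate (dn%:R / n%:R) - 3 * ln a - 3 * ln n%:R - 2 <=
  ln (2^-1 ^+ (n + dn.*2) * (first_passage_count n (n + dn.*2))%:R).
Proof.
move=> a1 n0 d0 kan.
have N0 : 0 < n%:R :> R by rewrite ltr0n.
have D0 : 0 < dn%:R :> R by rewrite ltr0n.
have N1 : 1 <= n%:R :> R by rewrite ler1n.
set k := (n + dn.*2)%N; set f := first_passage_count n k.
have kE : k = (n + dn + dn)%N by rewrite /k -addnn addnA.
have kR : k%:R = n%:R + 2 * dn%:R :> R by rewrite kE !natrD; ring.
have uR : (n + dn)%:R = n%:R + dn%:R :> R by rewrite natrD.
have fE : (k * f = n * 'C(k, dn))%N := first_passage_countE n dn.
have b0 : (0 < 'C(k, dn))%N by rewrite bin_gt0 kE leq_addl.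
have f0 : (0 < f)%N.
  have : (0 < k * f)%N by rewrite fE muln_gt0 n0.
  by rewrite muln_gt0 => /andP[].
have K0 : (0 < k)%N by rewrite kE; lia.
have lnf : ln k%:R + ln f%:R = ln n%:R + ln ('C(k, dn)%:R) :> R.
  by rewrite -!lnM ?posrE ?ltr0n// -!natrM fE.
have h20 : 0 < 2^-1 ^+ k :> R by rewrite exprn_gt0// invr_gt0.
split; first by rewrite mulr_gt0// ltr0n.
rewrite lnM ?posrE ?ltr0n// exprVn lnV ?posrE ?exprn_gt0// lnXn//.
have := @ln_bin_ge R (n + dn) dn; rewrite -kE => hbin.
have lnk : ln k%:R <= ln a + ln n%:R :> R.
  rewrite -lnM ?posrE//; last lra.
  by rewrite ler_ln ?posrE ?ltr0n// mulr_gt0//; lra.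
have lnu : ln (n + dn)%:R <= ln k%:R :> R.
  by rewrite ler_ln ?posrE ?ltr0n ?ler_nat//; lia.
have lnd : ln dn%:R <= ln k%:R :> R.
  by rewrite ler_ln ?posrE ?ltr0n ?ler_nat//; lia.
have lnn : 0 <= ln n%:R :> R by rewrite ln_ge0.
(* The [ln n] terms cancel because [k = (n + dn) + dn]. *)
have rE : n%:R * path_rate (dn%:R / n%:R) =
    - (k%:R * ln 2) + k%:R * ln k%:R - (n + dn)%:R * ln (n + dn)%:R
    - dn%:R * ln dn%:R :> R.
  rewrite /path_rate.
  have -> : 1 + 2 * (dn%:R / n%:R) = k%:R / n%:R :> R.
    by rewrite kR; field; rewrite gt_eqF.
  have -> : 1 + dn%:R / n%:R = (n + dn)%:R / n%:R :> R.
    by rewrite uR; field; rewrite gt_eqF.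
  rewrite !ln_div ?posrE ?ltr0n ?addn_gt0 ?n0//.
  by rewrite uR kR; field; rewrite gt_eqF.
rewrite rE -[ln 2 *+ k]mulr_natl.
move: hbin lnf lnk lnu lnd lnn; rewrite !uR kR. lra.
Qed.

Lemma chernoff_rate (a : R) : 1 < a ->
  exists q C : R, [/\ 0 < q, 1 <= C, C = (q + q^-1) / 2
    & ln q + a * ln C = hitting_rate a].
Proof.
move=> a1; rewrite hitting_rateE//.
(* Square roots of [a + 1] and [a - 1], written so that their logarithms are immediate; [q = m / p]
   minimizes [ln q + a * ln C]. *)
set p := expR (ln (a + 1) / 2); set m := expR (ln (a - 1) / 2).
have p0 : 0 < p by exact: expR_gt0.
have m0 : 0 < m by exact: expR_gt0.
have pE : p * p = a + 1.
  rewrite -expRD -[RHS]lnK ?posrE; last lra.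
  by congr expR; field.
have mE : m * m = a - 1.
  rewrite -expRD -[RHS]lnK ?posrE; last lra.
  by congr expR; field.
have CE : a / (p * m) = (m / p + (m / p)^-1) / 2.
  have -> : a = (p * p + m * m) / 2 by rewrite pE mE; field.
  by field; rewrite !gt_eqF.
exists (m / p), (a / (p * m)); split=> //; first exact: divr_gt0.
  rewrite ler_pdivlMr ?mulr_gt0// mul1r.
  rewrite -(@ler_pXn2r _ 2)// ?nnegrE ?mulr_ge0 ?ltW//; last lra.
  have -> : (p * m) ^+ 2 = (p * p) * (m * m) by ring.
  by rewrite pE mE; nra.
rewrite !ln_div ?posrE ?mulr_gt0//; last lra.
rewrite lnM ?posrE// /p /m !expRK.
by field.
Qed.

End Limits.

(** * Squeezing the logarithmic probability between the two bounds *)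

Theorem mainTheorem5 (R : realType) (d : measure_display)
    (T : measurableType d) (P : probability T R) (W : nat -> {RV P >-> int})
    (HW : symmetric_nn_walk W) (a : R) (ha : 1 < a) :
  exists c : R, 0 < c /\
    (fun n : nat =>
       (lne (P [set w |
          ((a * n%:R - c * Num.sqrt (n%:R * ln n%:R))%:E <= hitting_time R W n w
             <= (a * n%:R + c * Num.sqrt (n%:R * ln n%:R))%:E)%E])
        / n%:R%:E)%E) @ \oo
    --> (- ln ((a + 1) `^ ((a + 1) / 2) * (a - 1) `^ ((a - 1) / 2)
               * a `^ (- a)))%:E.
Proof.
(* The time [k = n + 2 * dn] lies within 2 below [a * n], and the square root is at least 1 for
   [n >= 2], so [c = 2] puts [k] in the window. *)
exists 2; split; first by [].
have [q [C [q0 C1 CE rateE]]] := chernoff_rate a ha.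
have b0 : 0 < (a - 1) / 2 by lra.
set dn := fun n : nat => Num.truncn (n%:R * ((a - 1) / 2)).
(* Logarithms of the two bounds divided by [n], with the truncation dropped in the upper one. *)
pose lower n : R := path_rate ((dn n)%:R / n%:R)
  - (3 * ln a + 2) * n%:R^-1 - 3 * (ln n%:R / n%:R).
pose upper n : R := ln q
  + (a + 2 * (Num.sqrt (n%:R * ln n%:R) / n%:R)) * ln C.
apply: (@squeeze_cvge _ _ _ _ (EFin \o lower) _ (EFin \o upper)).
- near=> n.
  have n2 : (2 <= n)%N by near: n; exists 2%N.
  have n0 : (0 < n)%N by lia.
  have N0 : 0 < n%:R :> R by rewrite ltr0n.
  have d0 : (0 < dn n)%N.
    rewrite /dn truncn_gt0 -ler_pdivrMr//.
    by near: n; exact: nbhs_infty_ger.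
  have /andP[dn1 dn2] := truncn_itv (ltW (mulr_gt0 N0 b0)).
  rewrite -/(dn n) in dn1 dn2; rewrite -[(dn n).+1%:R]natr1 in dn2.
  have kR : (n + (dn n).*2)%:R = n%:R + 2 * (dn n)%:R :> R.
    by rewrite natrD -mul2n natrM.
  have kan : (n + (dn n).*2)%:R <= a * n%:R by rewrite kR; lra.
  have s1 := @sqrt_nlnn_ge1 R n n2.
  have [pos rate] := ln_first_passage_count_ge a n (dn n) ha n0 d0 kan.
  set s := Num.sqrt (n%:R * ln n%:R) in s1 *.
  have lohi : a * n%:R - 2 * s <= (n + (dn n).*2)%:R <= a * n%:R + 2 * s.
    rewrite kR in kan *. by apply/andP; split; lra.
  have := prob_hitting_window_ge HW n _ _ _ lohi.
  have := prob_hitting_window_le HW q C n (a * n%:R - 2 * s) (a * n%:R + 2 * s) q0 CE.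
  rewrite /hitting_window; case: (P _) => [x||]//; rewrite !lee_fin => xu xl.
  (* Positivity comes from the path count and turns [lne] into the real logarithm. *)
  have x0 : 0 < x by exact: lt_le_trans xl.
  rewrite lne_EFin// inver gt_eqF// -EFinM !lee_fin.
  rewrite ler_pdivrMr// ler_pdivlMr//; apply/andP; split.
    apply: le_trans (_ : _ <= ln (2^-1 ^+ (n + (dn n).*2) *
      (first_passage_count n (n + (dn n).*2))%:R)) _; last first.
      by rewrite ler_ln// posrE.
    apply: le_trans rate; rewrite /lower le_eqVlt; apply/orP; left; apply/eqP.
    by field; rewrite gt_eqF.
  have C0 : 0 < C by exact: lt_le_trans ltr01 C1.
  apply: (@le_trans _ _ (ln (q ^+ n * C ^+ Num.truncn (a * n%:R + 2 * s)))).
    by rewrite ler_ln// posrE mulr_gt0// exprn_gt0.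
  rewrite lnM ?posrE ?exprn_gt0// !lnXn// -[ln q *+ n]mulr_natl.
  rewrite -[ln C *+ _]mulr_natl /upper -/s.
  have -> : (ln q + (a + 2 * (s / n%:R)) * ln C) * n%:R =
    n%:R * ln q + (a * n%:R + 2 * s) * ln C by field; rewrite gt_eqF.
  (* Since [ln C >= 0], the truncated time may be replaced by its real upper bound. *)
  rewrite lerD2l ler_wpM2r ?ln_ge0// truncn_le.
  have a0 : 0 <= a by exact: ltW (lt_trans ltr01 ha).
  by rewrite addr_ge0// ?mulr_ge0// (le_trans ler01 s1).
- apply: cvg_EFin; first exact: nearW.
  rewrite -/(hitting_rate a) -(path_rateE a ha) /lower.
  rewrite -[X in _ --> X]subr0 -[X in _ --> X - 0]subr0.
  apply: cvgB; last first.
    rewrite -[X in _ --> X](mulr0 3); apply: cvgM; first exact: cvg_cst.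
    exact: cvg_lnn_div.
  apply: cvgB; last first.
    rewrite -[X in _ --> X](mulr0 (3 * ln a + 2)).
    by apply: cvgM; [exact: cvg_cst|exact: cvg_invn].
  have := cvg_truncn_div _ b0; move/cvg_comp; apply.
  exact: continuous_path_rate.
- apply: cvg_EFin; first exact: nearW.
  rewrite -/(hitting_rate a) -rateE /upper.
  apply: cvgD; first exact: cvg_cst.
  apply: cvgM; last exact: cvg_cst.
  rewrite -[X in _ --> X]addr0; apply: cvgD; first exact: cvg_cst.
  rewrite -[X in _ --> X](mulr0 2); apply: cvgM; first exact: cvg_cst.
  exact: cvg_sqrt_nlnn_div.
Unshelve. all: by end_near. Qed.
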